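(* Consider the initial value problem $\dot{\boldsymbol{u}}(t)=\boldsymbol{f}(t,\boldsymbol{u}(t))$, $t\in[t_0,t_e]$, $\boldsymbol{u}(t_0)=\boldsymbol{u}_0$, with $\boldsymbol{f}:[t_0,t_e]\times\mathbb{R}^d\to\mathbb{R}^d$, and the quantity of interest $J(\boldsymbol{u})=\int_{t_0}^{t_e}j(t,\boldsymbol{u}(t))\,dt$ with density function $j:[t_0,t_e]\times\mathbb{R}^d\to\mathbb{R}$. Assume that $\boldsymbol{f}$ and $j$ are sufficiently smooth. For each tolerance $\tau>0$, let $t_0<\cdots<t_N=t_e$ be a mesh (depending on $\tau$) whose timesteps satisfy $\Delta t_n=t_{n+1}-t_n=\mathcal{O}(\tau^{1/q})$, and let $$J_h(\boldsymbol{u}_h)=\sum_{n=0}^{N-1}\Delta t_n\sum_{k=0}^{s}\sigma_k\, j(t_n^{(k)},\boldsymbol{u}_n^{(k)})$$ be the approximation of $J$ obtained by applying on each interval $[t_n,t_{n+1}]$ a quadrature scheme of order $r$ with evaluation points $t_n^{(k)}$ and weights $\sigma_k$. Assume further that the approximation $\boldsymbol{u}_h\approx\boldsymbol{u}(t)$, with values $\boldsymbol{u}_n^{(k)}\approx\boldsymbol{u}(t_n^{(k)})$, satisfies $$\boldsymbol{u}_n^{(k)}-\boldsymbol{u}(t_n^{(k)})=\mathcal{O}(\tau^{p/q})\quad\text{for all } n,k.$$ Then the error in the quantity of interest fulfills $$e^J:=|J(\boldsymbol{u})-J_h(\boldsymbol{u}_h)|=\mathcal{O}(\tau^{\min(r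,p)/q}).$$
   Context: The initial value problem is assumed to have a unique solution $\boldsymbol{u}$ on $[t_0,t_e]$. ''Sufficiently smooth'' means having as many continuous derivatives as required by the orders involved. All $\mathcal{O}$ statements are for $\tau\to0$, with constants uniform in $n$ and $k$; $p,q>0$. The quadrature scheme is fixed, i.e. $s$ and the weights $\sigma_k$ do not depend on $n$ or $\tau$, and $t_n^{(k)}=t_n+\gamma_k\Delta t_n\in[t_n,t_{n+1}]$ with fixed $\gamma_k\in[0,1]$. It has order $r$ in the usual sense: its error on an interval of length $\Delta t$ is bounded by $c_q\,\Delta t^{r+1}\max|g^{(r)}|$ for a sufficiently smooth integrand $g$, where $c_q$ is a constant of the scheme. *)

(* Defs.v *)
From HB Require Import structures.
From mathcomp Require Import all_boot all_order all_algebra.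
From mathcomp Require Import all_classical all_reals all_analysis.

Set Implicit Arguments.
Unset Strict Implicit.
Unset Printing Implicit Defensive.

Import Order.TTheory GRing.Theory Num.Theory.
Import numFieldNormedType.Exports.

Local Open Scope classical_set_scope.
Local Open Scope ring_scope.

(* Frechet differentiability relative to D: at boundary points of D only
   increments staying in D are tested. *)
Definition frechet_within (R : realType) (V W : normedModType R) (D : set V)
    (g : V -> W) (z : V) (dg : {linear V -> W}) : Prop :=
  forall e : R, 0 < e ->
    \forall y \near within D (nbhs z),
      `|g y - g z - dg (y - z)| <= e * `|y - z|.

(* Class C^k on D. The derivative is required to be C^(k-1) direction by
   direction, which is the usual notion when V is finite-dimensional, the only
   case used here. *)
Fixpoint smooth_on (R : realType) (V W : normedModType R) (k : nat)
    (D : set V) (g : V -> W) : Prop :=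
  match k with
  | 0%N => {within D, continuous g}
  | k'.+1 => exists dg : V -> {linear V -> W},
      (forall z, D z -> frechet_within D g z (dg z)) /\
      (forall v : V, smooth_on k' D (fun z => dg z v))
  end.

(* Class C^k on [t0, te] x R^d; only the values of g there matter. *)
Definition smooth_on_strip (R : realType) (d : nat) (W : normedModType R)
    (k : nat) (t0 te : R) (g : R -> 'rV[R]_d -> W) : Prop :=
  @smooth_on R (R * 'rV[R]_d)%type W k (`[t0, te] `*` setT)
    (fun z => g z.1 z.2).

(* Derivative of a curve relative to A, one-sided at the endpoints when A is a
   closed interval. *)
Definition derivative_within (R : realType) (W : normedModType R) (A : set R)
    (g : R -> W) (t : R) (l : W) : Prop :=
  (y - t)^-1 *: (g y - g t) @[y --> within A t^'] --> l.

Definition ivp_solution (R : realType) (d : nat) (t0 te : R)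
    (f : R -> 'rV[R]_d -> 'rV[R]_d) (u0 : 'rV[R]_d) (u : R -> 'rV[R]_d) : Prop :=
  u t0 = u0 /\
  forall t, t \in `[t0, te] -> derivative_within `[t0, te] u t (f t (u t)).

Definition unique_ivp_solution (R : realType) (d : nat) (t0 te : R)
    (f : R -> 'rV[R]_d -> 'rV[R]_d) (u0 : 'rV[R]_d) (u : R -> 'rV[R]_d) : Prop :=
  ivp_solution t0 te f u0 u /\
  forall v, ivp_solution t0 te f u0 v ->
    forall t, t \in `[t0, te] -> v t = u t.

(* G 0 is of class C^r on [a, b], with successive derivatives G 1, ..., G r. *)
Definition derivatives_on (R : realType) (a b : R) (r : nat)
    (G : nat -> R -> R) : Prop :=
  (forall i, (i < r)%N -> forall t, t \in `[a, b] ->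
     derivative_within `[a, b] (G i) t (G i.+1 t)) /\
  {within `[a, b], continuous (G r)}.

Definition quadrature (R : realType) (s : nat) (gamma sigma : 'I_s.+1 -> R)
    (a dt : R) (g : R -> R) : R :=
  dt * \sum_(k < s.+1) sigma k * g (a + gamma k * dt).

Definition quadrature_order (R : realType) (s : nat)
    (gamma sigma : 'I_s.+1 -> R) (r : nat) : Prop :=
  exists cq : R, forall (a dt : R) (G : nat -> R -> R),
    0 < dt -> derivatives_on a (a + dt) r G ->
    `| \int[lebesgue_measure]_(t in `[a, (a + dt)%R]) G 0%N t
       - quadrature gamma sigma a dt (G 0%N) |
    <= cq * dt ^+ r.+1 * sup [set `|G r t| | t in `[a, a + dt]].

Definition is_mesh (R : realType) (t0 te : R) (N : nat) (t : nat -> R) : Prop :=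
  [/\ t 0%N = t0, t N = te & forall n, (n < N)%N -> t n < t n.+1].

Definition timestep (R : realType) (t : nat -> R) (n : nat) : R :=
  t n.+1 - t n.

Definition node (R : realType) (s : nat) (gamma : 'I_s.+1 -> R)
    (t : nat -> R) (n : nat) (k : 'I_s.+1) : R :=
  t n + gamma k * timestep t n.

Definition qoi (R : realType) (d : nat) (t0 te : R) (j : R -> 'rV[R]_d -> R)
    (u : R -> 'rV[R]_d) : R :=
  \int[lebesgue_measure]_(t in `[t0, te]) j t (u t).

Definition qoi_h (R : realType) (d s : nat) (gamma sigma : 'I_s.+1 -> R)
    (j : R -> 'rV[R]_d -> R) (N : nat) (t : nat -> R)
    (uh : nat -> 'I_s.+1 -> 'rV[R]_d) : R :=
  \sum_(n < N) timestep t n *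
    \sum_(k < s.+1) sigma k * j (node gamma t n k) (uh n k).

(* Main.v *)
Require Import Defs.
From HB Require Import structures.
From mathcomp Require Import all_boot all_order all_algebra.
From mathcomp Require Import all_classical all_reals all_analysis.
From mathcomp Require Import ring lra.

Set Implicit Arguments.
Unset Strict Implicit.
Unset Printing Implicit Defensive.

Import Order.TTheory GRing.Theory Num.Theory.
Import numFieldNormedType.Exports.

Local Open Scope classical_set_scope.
Local Open Scope ring_scope.

(** The error splits, by inserting the quadrature rule applied to the exact
    integrand [g y = j y (u y)], into a quadrature error and a perturbation
    error.

    - Quadrature error ([composite_quadrature_error]). On each cell the order
      [r] of the rule gives at most [cq * dt ^+ r.+1 * max |g^(r)|]. One factor
      [dt] is spent on the sum over the cells, whose lengths add up to
      [te - t0] whatever their number; the other [r] are each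
      [O(tau `^ (1 / q))], which leaves [O(tau `^ (r / q))].
    - Perturbation error ([qoi_perturbation]). The density [j] is Lipschitz in
      the state on bounded sets ([strip_lipschitz]), and the weights are fixed,
      so replacing [u] by [uh] at the nodes costs [O(tau `^ (p / q))].

    Since [tau <= 1], both powers are below [tau `^ (min r p / q)].

    The first estimate presupposes that [g] is of class C^r. The solution is
    only given as a differentiable curve, and its smoothness is obtained
    together with that of [g] ([derivatives_along_flow]): the curve
    [c y = (y, u y)] solves the autonomous equation [c' = F c] with
    [F (y, v) = (1, f y v)], so the derivative of [phi \o c] is [psi \o c] where
    [psi z = dphi z (F z)]. If [phi] is C^k and [F] is C^(k-1), then [psi] is
    C^(k-1), being a sum of products of C^(k-1) functions, and induction on [k]
    applies to [psi]. No derivative of [u] is ever formed beyond the first.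

    Smoothness on the strip is tested by Frechet derivatives whose linear maps
    carry no continuity requirement, so the calculus below is developed on
    spaces with finitely many coordinates bounded by the norm, where every
    linear map is bounded. *)

(** * Relative Frechet derivatives *)

(** A finite family [e] spanning [V] with controlled coefficients [x]: this is how
    finite-dimensionality enters, through [linear_norm_le]. The constant 1 in
    the bound fits the maximum norm of R * R^d. *)
Definition coordinate_system (R : realType) (V : normedModType R) (n : nat)
    (e : 'I_n -> V) (x : 'I_n -> V -> R) : Prop :=
  forall v, v = \sum_(i < n) x i v *: e i /\ forall i, `|x i v| <= `|v|.

Lemma linear_norm_le (R : realType) (V W : normedModType R) (n : nat)
    (e : 'I_n -> V) (x : 'I_n -> V -> R) (L : {linear V -> W}) (v : V) :
  coordinate_system e x -> `|L v| <= (\sum_(i < n) `|L (e i)|) * `|v|.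
Proof.
move=> /(_ v) [vE xle]; rewrite {1}vE linear_sum mulr_suml.
apply: (le_trans (ler_norm_sum _ _ _)); apply: ler_sum => i _.
by rewrite linearZ normrZ mulrC ler_wpM2l.
Qed.

Lemma frechet_within_lipschitz_at (R : realType) (V W : normedModType R)
    (D : set V) (g : V -> W) (z : V) (dg : {linear V -> W}) (M : R) :
  (forall v, `|dg v| <= M * `|v|) -> frechet_within D g z dg ->
  \forall y \near within D (nbhs z), `|g y - g z| <= (M + 1) * `|y - z|.
Proof.
move=> dgM /(_ 1 ltr01); apply: filterS => y; rewrite mul1r => gy.
rewrite -[g y - g z](subrK (dg (y - z))) addrC mulrDl mul1r.
by apply: (le_trans (ler_normD _ _)); apply: lerD.
Qed.

(** A bound on the linear map has to be supplied: an unbounded one would be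
    allowed as derivative at a point of discontinuity. *)
Lemma frechet_within_cvg (R : realType) (V W : normedModType R)
    (D : set V) (g : V -> W) (z : V) (dg : {linear V -> W}) (M : R) :
  (forall v, `|dg v| <= M * `|v|) -> frechet_within D g z dg ->
  g y @[y --> within D (nbhs z)] --> g z.
Proof.
move=> dgM /(frechet_within_lipschitz_at dgM) lip.
apply/cvgrPdist_le => e e0.
pose C : R := Num.max (M + 1) 1.
have C0 : 0 < C by rewrite lt_max ltr01 orbT.
have : \forall y \near within D (nbhs z), `|z - y| <= e / C.
  have /cvgrPdist_le : y @[y --> within D (nbhs z)] --> z by exact: cvg_within.
  by move=> /(_ (e / C)); apply; rewrite divr_gt0.
move: lip; apply: filterS2 => y lip zy.
rewrite distrC; apply: (le_trans lip).
rewrite ler_pdivlMr // in zy.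
apply: (le_trans _ zy); rewrite mulrC distrC ler_wpM2l // le_max lexx //.
Qed.

Lemma frechet_withinD (R : realType) (V W : normedModType R) (D : set V)
    (g h : V -> W) (z : V) (dg dh : {linear V -> W}) :
  frechet_within D g z dg -> frechet_within D h z dh ->
  frechet_within D (g \+ h) z (dg \+ dh).
Proof.
move=> Dg Dh e e0; have e20 : 0 < e / 2 by rewrite divr_gt0.
move: (Dg _ e20) (Dh _ e20); apply: filterS2 => y gy hy /=.
have -> : g y + h y - (g z + h z) - (dg (y - z) + dh (y - z)) =
    (g y - g z - dg (y - z)) + (h y - h z - dh (y - z)).
  by rewrite (opprD (g z)) (addrACA (g y)) (opprD (dg _)) [LHS]addrACA.
apply: (le_trans (ler_normD _ _)); apply: (le_trans (lerD gy hy)).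
by rewrite -mulrDl -splitr.
Qed.

(** The derivative of a product, with [a] and [b] the values of the factors. *)
Definition leibniz (R : realType) (V : normedModType R) (a b : R)
    (dg dh : {linear V -> R}) (v : V) : R :=
  a * dh v + b * dg v.

Lemma leibniz_is_linear (R : realType) (V : normedModType R) (a b : R)
    (dg dh : {linear V -> R}) : linear (leibniz a b dg dh).
Proof.
by move=> c v w; rewrite /leibniz (linearP dg) (linearP dh) /GRing.scale /=; ring.
Qed.

HB.instance Definition _ (R : realType) (V : normedModType R) (a b : R)
    (dg dh : {linear V -> R}) :=
  GRing.isLinear.Build R V R _ (leibniz a b dg dh)
    (leibniz_is_linear a b dg dh).

(** The remainder of the product is that of each factor, weighted by the value of
    the other, plus [(g y - g z) * (h y - h z)]; in the latter the first factor
    tends to 0 and the second is [O(`|y - z|)]. *)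
Lemma frechet_withinM (R : realType) (V : normedModType R) (D : set V)
    (g h : V -> R) (z : V) (dg dh : {linear V -> R}) (M : R) :
  (forall v, `|dh v| <= M * `|v|) ->
  g y @[y --> within D (nbhs z)] --> g z ->
  frechet_within D g z dg -> frechet_within D h z dh ->
  frechet_within D (fun y => g y * h y) z (leibniz (g z) (h z) dg dh).
Proof.
move=> dhM cg Dg Dh e e0.
(* C is the sum of the three weights that the tolerance e / C receives below,
   plus 1 to make it positive. *)
pose C : R := `|g z| + `|h z| + `|M + 1| + 1.
have C0 : 0 < C by rewrite ltr_wpDl // !addr_ge0.
have eC0 : 0 < e / C by rewrite divr_gt0.
have lip := frechet_within_lipschitz_at dhM Dh.
have cge : \forall y \near within D (nbhs z), `|g z - g y| <= e / C.
  exact: cvgr_dist_le.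
near=> y.
have hy : `|h y - h z - dh (y - z)| <= e / C * `|y - z|.
  by near: y; exact: Dh.
have gy : `|g y - g z - dg (y - z)| <= e / C * `|y - z|.
  by near: y; exact: Dg.
have ly : `|h y - h z| <= (M + 1) * `|y - z| by near: y.
have cy : `|g z - g y| <= e / C by near: y.
rewrite /leibniz.
have -> : g y * h y - g z * h z - (g z * dh (y - z) + h z * dg (y - z)) =
   g z * (h y - h z - dh (y - z)) + h z * (g y - g z - dg (y - z))
   + (g y - g z) * (h y - h z) by ring.
have -> : e * `|y - z| = (`|g z| + `|h z|) * (e / C * `|y - z|)
    + (`|M + 1| + 1) * (e / C) * `|y - z|.
  rewrite mulrA -mulrDl -mulrDl addrA -/C mulrCA divff ?mulr1 //.
  by rewrite gt_eqF.
apply: (le_trans (ler_normD _ _)); apply: lerD.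
  rewrite mulrDl; apply: (le_trans (ler_normD _ _)).
  by apply: lerD; rewrite normrM ler_wpM2l.
rewrite normrM distrC mulrAC [X in _ <= X]mulrC.
apply: ler_pM => //.
apply: (le_trans ly); rewrite ler_wpM2r //.
by rewrite (le_trans (ler_norm _)) // lerDl.
Unshelve. all: by end_near.
Qed.

(** * Functions of class C^k relative to a set *)

Lemma smooth_on0P (R : realType) (V W : normedModType R) (D : set V)
    (g : V -> W) :
  smooth_on 0 D g <-> forall z, D z -> g y @[y --> within D (nbhs z)] --> g z.
Proof. exact: subspace_continuousP. Qed.

(** Not immediate from the recursive definition, which never asks [g] itself to
    be continuous when [k > 0]; boundedness of the linear maps is what provides
    it. *)
Lemma smooth_onS (R : realType) (V W : normedModType R) (n : nat)
    (e : 'I_n -> V) (x : 'I_n -> V -> R) (k : nat) (D : set V) (g : V -> W) :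
  coordinate_system e x -> smooth_on k.+1 D g -> smooth_on k D g.
Proof.
move=> ex; elim: k g => [|k IH] g [dg [Dg sdg]].
  apply/smooth_on0P => z Dz.
  exact: (frechet_within_cvg (fun v => linear_norm_le _ v ex) (Dg _ Dz)).
by exists dg; split=> // v; exact: IH.
Qed.

Lemma smooth_on_le (R : realType) (V W : normedModType R) (n : nat)
    (e : 'I_n -> V) (x : 'I_n -> V -> R) (k l : nat) (D : set V) (g : V -> W) :
  coordinate_system e x -> (k <= l)%N -> smooth_on l D g -> smooth_on k D g.
Proof.
move=> ex; elim: l => [|l IH]; first by rewrite leqn0 => /eqP ->.
rewrite leq_eqVlt => /predU1P[-> //|kl] /(smooth_onS ex); exact: IH.
Qed.

Lemma smooth_on_cst (R : realType) (V W : normedModType R) (k : nat)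
    (D : set V) (c : W) : smooth_on k D (fun=> c).
Proof.
elim: k c => [|k IH] c; first by apply/smooth_on0P => z _; exact: cvg_cst.
exists (fun=> \0); split=> [z _ e e0|v]; last exact: IH.
by near=> y; rewrite /= subr0 subrr normr0 mulr_ge0 // ltW.
Unshelve. all: by end_near.
Qed.

Lemma smooth_onD (R : realType) (V W : normedModType R) (k : nat)
    (D : set V) (g h : V -> W) :
  smooth_on k D g -> smooth_on k D h -> smooth_on k D (g \+ h).
Proof.
elim: k g h => [|k IH] g h.
  move=> /smooth_on0P sg /smooth_on0P sh; apply/smooth_on0P => z Dz.
  by apply: cvgD; [exact: sg | exact: sh].
move=> [dg [Dg sdg]] [dh [Dh sdh]].
exists (fun z => dg z \+ dh z); split=> [z Dz|v].
  by apply: frechet_withinD; [exact: Dg | exact: Dh].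
exact: (IH _ _ (sdg v) (sdh v)).
Qed.

Lemma smooth_on_sum (R : realType) (V W : normedModType R) (k : nat)
    (D : set V) (m : nat) (g : 'I_m -> V -> W) :
  (forall i, smooth_on k D (g i)) ->
  smooth_on k D (fun z => \sum_(i < m) g i z).
Proof.
elim: m g => [|m IH] g sg.
  under eq_fun do rewrite big_ord0; exact: smooth_on_cst.
under eq_fun do rewrite big_ord_recr /=.
by apply: (smooth_onD (IH _ _) (sg ord_max)) => i; exact: sg.
Qed.

(** By induction, the derivative in direction [v] is a sum of products of a factor
    and a derivative; the undifferentiated factors are used one class lower. *)
Lemma smooth_onM (R : realType) (V : normedModType R) (n : nat)
    (e : 'I_n -> V) (x : 'I_n -> V -> R) (k : nat) (D : set V) (g h : V -> R) :
  coordinate_system e x ->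
  smooth_on k D g -> smooth_on k D h -> smooth_on k D (fun z => g z * h z).
Proof.
move=> ex; elim: k g h => [|k IH] g h.
  move=> /smooth_on0P sg /smooth_on0P sh; apply/smooth_on0P => z Dz.
  by apply: cvgM; [exact: sg | exact: sh].
move=> sg sh; have [sg' sh'] := (smooth_onS ex sg, smooth_onS ex sh).
move: sg sh => [dg [Dg sdg]] [dh [Dh sdh]].
exists (fun z => leibniz (g z) (h z) (dg z) (dh z)); split=> [z Dz|v].
  apply: (frechet_withinM (fun v => linear_norm_le _ v ex) _ (Dg _ Dz) (Dh _ Dz)).
  exact: (frechet_within_cvg (fun v => linear_norm_le _ v ex) (Dg _ Dz)).
exact: (smooth_onD (IH _ _ sg' (sdh v)) (IH _ _ sh' (sdg v))).
Qed.

Lemma row_coord_le (R : realType) (d : nat) (v : 'rV[R]_d) (i : 'I_d) :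
  `|v ord0 i| <= `|v|.
Proof.
rewrite [`|v|]mx_normrE.
exact: (le_bigmax _ (fun ij : 'I_1 * 'I_d => `|v ij.1 ij.2|) (ord0, i)).
Qed.

Definition linear_coord (R : realType) (V : normedModType R) (d : nat)
    (i : 'I_d) (L : {linear V -> 'rV[R]_d}) (v : V) : R := L v ord0 i.

Lemma linear_coord_is_linear (R : realType) (V : normedModType R) (d : nat)
    (i : 'I_d) (L : {linear V -> 'rV[R]_d}) : linear (linear_coord i L).
Proof. by move=> c v w; rewrite /linear_coord linearP !mxE. Qed.

HB.instance Definition _ (R : realType) (V : normedModType R) (d : nat)
    (i : 'I_d) (L : {linear V -> 'rV[R]_d}) :=
  GRing.isLinear.Build R V R _ (linear_coord i L) (linear_coord_is_linear i L).

Lemma smooth_on_coord (R : realType) (V : normedModType R) (d k : nat)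
    (D : set V) (g : V -> 'rV[R]_d) (i : 'I_d) :
  smooth_on k D g -> smooth_on k D (fun z => g z ord0 i).
Proof.
elim: k g => [|k IH] g.
  move=> /smooth_on0P sg; apply/smooth_on0P => z /sg gz.
  exact: (cvg_comp _ _ gz (@coord_continuous _ _ _ ord0 i _)).
move=> [dg [Dg sdg]]; exists (fun z => linear_coord i (dg z)).
split=> [z Dz e e0|v]; last exact: IH (sdg v).
move: (Dg z Dz e e0); apply: filterS => y; apply: le_trans.
by have := row_coord_le (g y - g z - dg z (y - z)) i; rewrite !mxE.
Qed.

(** * Curves *)

(** Clearing the denominator makes this the one-dimensional analogue of
    [frechet_within], free of the exclusion of the point [t] itself. *)
Lemma derivative_withinP (R : realType) (W : normedModType R) (A : set R)
    (c : R -> W) (t : R) (l : W) :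
  derivative_within A c t l <-> forall e : R, 0 < e ->
    \forall y \near within A (nbhs t),
      `|c y - c t - (y - t) *: l| <= e * `|y - t|.
Proof.
have eqq y : y != t ->
    `|l - (y - t)^-1 *: (c y - c t)| * `|y - t| = `|c y - c t - (y - t) *: l|.
  rewrite -subr_eq0 => yt; rewrite mulrC -normrZ scalerBr scalerA divff //.
  by rewrite scale1r distrC.
rewrite /derivative_within; split.
  move=> /cvgrPdist_le dc e e0; have := dc e e0.
  rewrite !near_withinE; apply: filterS => y yA Ay; have [->|yt] := eqVneq y t.
    by rewrite !subrr scale0r subr0 normr0 mulr_ge0 // ltW.
  by rewrite -eqq // ler_wpM2r // yA.
move=> dc; apply/cvgrPdist_le => e e0; have := dc e e0.
rewrite !near_withinE; apply: filterS => y yA yt Ay; have := yA Ay.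
by rewrite -eqq // ler_pM2r // normr_gt0 subr_eq0.
Qed.

Lemma derivative_within_lipschitz_at (R : realType) (W : normedModType R)
    (A : set R) (c : R -> W) (t : R) (l : W) :
  derivative_within A c t l ->
  \forall y \near within A (nbhs t), `|c y - c t| <= (`|l| + 1) * `|y - t|.
Proof.
move=> /derivative_withinP /(_ 1 ltr01); apply: filterS => y; rewrite mul1r => cy.
rewrite -[c y - c t](subrK ((y - t) *: l)) addrC mulrDl mul1r.
by apply: (le_trans (ler_normD _ _)); apply: lerD; rewrite // normrZ mulrC.
Qed.

Lemma derivative_within_cvg (R : realType) (W : normedModType R) (A : set R)
    (c : R -> W) (t : R) (l : W) :
  derivative_within A c t l -> c y @[y --> within A (nbhs t)] --> c t.
Proof.
move=> /derivative_within_lipschitz_at lip.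
apply/cvgrPdist_le => e e0.
have C0 : 0 < `|l| + 1 by rewrite ltr_wpDl.
have : \forall y \near within A (nbhs t), `|t - y| <= e / (`|l| + 1).
  have /cvgrPdist_le : y @[y --> within A (nbhs t)] --> t by exact: cvg_within.
  by move=> /(_ (e / (`|l| + 1))); apply; rewrite divr_gt0.
move: lip; apply: filterS2 => y lip ty.
rewrite distrC; apply: (le_trans lip).
by rewrite ler_pdivlMr // in ty; rewrite mulrC distrC.
Qed.

Lemma derivative_within_continuous (R : realType) (W : normedModType R)
    (A : set R) (c dc : R -> W) :
  (forall t, A t -> derivative_within A c t (dc t)) ->
  {within A, continuous c}.
Proof.
move=> cA; apply/subspace_continuousP => t At.
exact: derivative_within_cvg (cA _ At).
Qed.

Lemma derivative_within_subset (R : realType) (W : normedModType R)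
    (A B : set R) (c : R -> W) (t : R) (l : W) :
  B `<=` A -> derivative_within A c t l -> derivative_within B c t l.
Proof.
move=> BA /derivative_withinP dc; apply/derivative_withinP => e /dc.
by rewrite !near_withinE; apply: filterS => y yA /BA.
Qed.

(** Chain rule. The remainder is that of [g] at the increment of [c], itself
    [O(`|y - t|)], plus [dg] applied to the remainder of [c]; each gets half of
    the tolerance. *)
Lemma derivative_within_comp (R : realType) (V W : normedModType R) (D : set V)
    (A : set R) (g : V -> W) (c : R -> V) (t : R) (l : V)
    (dg : {linear V -> W}) (M : R) :
  (forall v, `|dg v| <= M * `|v|) -> (forall y, A y -> D (c y)) ->
  derivative_within A c t l -> frechet_within D g (c t) dg ->
  derivative_within A (fun y => g (c y)) t (dg l).
Proof.
move=> dgM cD dc Dg; apply/derivative_withinP => e e0.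
have lip := derivative_within_lipschitz_at dc.
have ccvg := derivative_within_cvg dc.
move/derivative_withinP : dc => dc.
have l1 : 0 < `|l| + 1 by rewrite ltr_wpDl.
have M1 : 0 < `|M| + 1 by rewrite ltr_wpDl.
pose e1 := e / 2 / (`|M| + 1); pose e2 := e / 2 / (`|l| + 1).
have e10 : 0 < e1 by rewrite !divr_gt0.
have e20 : 0 < e2 by rewrite !divr_gt0.
have Dgc : \forall y \near within A (nbhs t),
    `|g (c y) - g (c t) - dg (c y - c t)| <= e2 * `|c y - c t|.
  have : \forall y \near within A (nbhs t), D (c y) ->
      `|g (c y) - g (c t) - dg (c y - c t)| <= e2 * `|c y - c t|.
    exact: ccvg _ (Dg _ e20).
  rewrite !near_withinE; apply: filterS => y gy Ay.
  by apply: gy => //; exact: cD.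
near=> y.
have gy : `|g (c y) - g (c t) - dg (c y - c t)| <= e2 * `|c y - c t| by near: y.
have cy : `|c y - c t| <= (`|l| + 1) * `|y - t| by near: y.
have dy : `|c y - c t - (y - t) *: l| <= e1 * `|y - t| by near: y; exact: dc.
have -> : g (c y) - g (c t) - (y - t) *: dg l =
    (g (c y) - g (c t) - dg (c y - c t)) + dg (c y - c t - (y - t) *: l).
  by rewrite (linearB dg (c y - c t)) [RHS]addrA subrK (linearZ_LR dg).
rewrite (splitr e) mulrDl.
apply: (le_trans (ler_normD _ _)); apply: lerD.
  apply: (le_trans gy); apply: (le_trans (ler_wpM2l (ltW e20) cy)).
  by rewrite mulrA divfK // gt_eqF.
apply: (le_trans (dgM _)).
apply: (@le_trans _ _ ((`|M| + 1) * (e1 * `|y - t|))); last first.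
  by rewrite mulrA mulrCA divff ?mulr1 // gt_eqF.
apply: le_trans (ler_wpM2l (ltW M1) dy); rewrite ler_wpM2r //.
by rewrite (le_trans (ler_norm M)) // lerDl.
Unshelve. all: by end_near.
Qed.

(** Gives access to the mean value theorem for functions known only through
    relative derivatives: near an interior point every increment is tested. *)
Lemma derivative_within_is_derive (R : realType) (a b : R) (h : R -> R)
    (t l : R) :
  t \in `]a, b[ -> derivative_within `[a, b] h t l -> is_derive t 1 h l.
Proof.
move=> tab /derivative_withinP dh.
have {}dh e : 0 < e -> \forall y \near nbhs t,
    `|h y - h t - (y - t) *: l| <= e * `|y - t|.
  move=> /dh; rewrite near_withinE; apply: filter_app; near=> y; apply.
  by apply: subset_itv_oo_cc; near: y; exact: near_in_itvoo.
have cv : (fun k => k^-1 *: (h (k *: 1 + t) - h t)) @ (0 : R)^' --> l.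
  apply/cvgrPdist_le => e /dh; rewrite -nbhs_nearE => /nbhs_ballP [r /= r0 hr].
  rewrite /prop_near1 /= /dnbhs /within /=.
  apply/nbhs_ballP; exists r => //= k; rewrite /ball /= sub0r normrN => kr k0.
  have := hr (k + t); rewrite /ball /= opprD addrCA subrr addr0 normrN.
  move=> /(_ kr); rewrite addrK.
  rewrite /GRing.scale /= mulr1 => hk.
  rewrite -(@ler_pM2r _ `|k|) ?normr_gt0 // -normrM mulrBl.
  by rewrite mulrAC mulVf // mul1r distrC (mulrC l).
apply: DeriveDef; first by apply/cvg_ex; exists l.
exact: cvg_lim cv.
Unshelve. all: by end_near.
Qed.

(** The derivative of [phi \o c] along an integral curve of [F] is [psi \o c] with
    [psi z = dphi z (F z)], again a function on [D], of one class less. Iterating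
    therefore stays among functions of this form. In coordinates,
    [psi z = \sum_i x i (F z) * dphi z (e i)], which exhibits its smoothness. *)
Lemma derivatives_along_flow (R : realType) (V : normedModType R) (n : nat)
    (e : 'I_n -> V) (x : 'I_n -> V -> R) (D : set V) (a b : R)
    (F : V -> V) (c : R -> V) (k : nat) (phi : V -> R) :
  coordinate_system e x ->
  (forall t, t \in `[a, b] -> D (c t)) ->
  (forall t, t \in `[a, b] -> derivative_within `[a, b] c t (F (c t))) ->
  (forall i, smooth_on k.-1 D (fun z => x i (F z))) ->
  smooth_on k D phi ->
  exists2 G : nat -> R -> R,
    G 0%N = (fun t => phi (c t)) & derivatives_on a b k G.
Proof.
move=> ex cD dc; elim: k phi => [|k IH] phi sF sphi.
  exists (fun=> fun t => phi (c t)) => //; split=> //.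
  apply/subspace_continuousP => t tab.
  move/smooth_on0P : sphi => /(_ _ (cD _ tab)) sphi.
  have ccvg := derivative_within_cvg (dc _ tab).
  move=> U /sphi phiU.
  have : \forall y \near within `[a, b] (nbhs t), D (c y) -> U (phi (c y)).
    exact: ccvg _ phiU.
  rewrite near_simpl !near_withinE; apply: filterS => y yD Ay.
  by apply: yD => //; exact: cD.
have [dphi [Dphi sdphi]] := sphi.
pose psi z := dphi z (F z).
have spsi : smooth_on k D psi.
  have -> : psi = fun z => \sum_(i < n) x i (F z) * dphi z (e i).
    apply/funext => z; rewrite /psi {1}(proj1 (ex (F z))) linear_sum.
    by apply: eq_bigr => i _; rewrite linearZ.
  by apply: smooth_on_sum => i; exact: (smooth_onM ex (sF i) (sdphi (e i))).
have [|G G0 [dG cG]] := IH psi _ spsi.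
  by move=> i; apply: (smooth_on_le ex (leq_pred k)); exact: sF.
exists (fun i => if i is i'.+1 then G i' else fun t => phi (c t)) => //.
split=> [[_ t tab|i ik t tab]|//].
  rewrite G0 /psi.
  apply: (derivative_within_comp (fun v => linear_norm_le _ v ex) cD) => //.
    exact: dc.
  by apply: Dphi; exact: cD.
exact: dG.
Qed.

(** * Lipschitz continuity on compact convex sets *)

Lemma within_continuous_bounded (R : realType) (V W : normedModType R)
    (D K : set V) (g : V -> W) :
  compact K -> K `<=` D -> {within D, continuous g} ->
  exists M : R, forall z, K z -> `|g z| <= M.
Proof.
move=> cK KD cg.
have /(continuous_compact)/(_ cK)/compact_bounded : {within K, continuous g}.
  exact: continuous_subspaceW KD cg.
move=> /pinfty_ex_gt0[M _ gM]; exists M => z Kz; apply: gM.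
by exists z.
Qed.

(** Mean value theorem along the segment from [w] to [z]. The partial derivatives
    [fun z => dg z (e i)] are continuous, hence bounded on [K], and the sum of
    their bounds controls [dg] uniformly on [K]. *)
Lemma smooth_on1_lipschitz (R : realType) (V : normedModType R) (n : nat)
    (e : 'I_n -> V) (x : 'I_n -> V -> R) (D K : set V) (g : V -> R) :
  coordinate_system e x -> compact K -> K `<=` D ->
  (forall z w (s : R), K z -> K w -> s \in `[0, 1] -> K (w + s *: (z - w))) ->
  smooth_on 1 D g ->
  exists L : R, forall z w, K z -> K w -> `|g z - g w| <= L * `|z - w|.
Proof.
move=> ex cK KD convK [dg [Dg sdg]].
have /choice[B dgB] : forall i, exists M : R, forall z, K z -> `|dg z (e i)| <= M.
  by move=> i; apply: (within_continuous_bounded cK KD); exact: sdg.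
exists (\sum_(i < n) B i) => z w Kz Kw.
pose c (s : R) := w + s *: (z - w).
have cE s : c s = w + s *: (z - w) by [].
have dc s : derivative_within `[0, 1] c s (z - w).
  apply/derivative_withinP => r r0; near=> y.
  have -> : c y - c s = (y - s) *: (z - w).
    by rewrite !cE opprD addrACA subrr add0r -scalerBl.
  rewrite subrr normr0.
  by rewrite mulr_ge0 // ltW //; apply: r0.
have Kc (s : R) : `[0, 1]%classic s -> K (c s) by move=> s01; exact: convK.
have dgc (s : R) : s \in `[0, 1] ->
    derivative_within `[0, 1] (fun s => g (c s)) s (dg (c s) (z - w)).
  move=> s01; have Kcs := Kc _ s01.
  apply: (@derivative_within_comp _ _ _ D _ _ c _ _ _ _
    (fun v => linear_norm_le _ v ex) _ (dc s) (Dg _ (KD _ Kcs))).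
  by move=> y /Kc /KD.
have der (s : R) : s \in `]0, 1[ ->
    is_derive s 1 (fun s => g (c s)) (dg (c s) (z - w)).
  move=> s01; apply: (derivative_within_is_derive s01); apply: dgc.
  exact: subset_itv_oo_cc s01.
have [s s01] := MVT_segment ler01 der (derivative_within_continuous dgc).
rewrite subr0 mulr1 !cE scale1r scale0r addr0 addrCA subrr addr0 => ->.
apply: (le_trans (linear_norm_le _ _ ex)); rewrite ler_wpM2r //.
by apply: ler_sum => i _; apply: dgB; exact: Kc.
Unshelve. all: by end_near.
Qed.

(** * Coordinates on R x R^d *)

(** The index 0 is the time direction; the others are the directions of R^d. *)
Definition strip_basis (R : realType) (d : nat) (i : 'I_d.+1) :
    (R * 'rV[R]_d)%type :=
  if unlift ord0 i is Some k then (0, delta_mx ord0 k) else (1, 0).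

Definition strip_coord (R : realType) (d : nat) (i : 'I_d.+1)
    (v : (R * 'rV[R]_d)%type) : R :=
  if unlift ord0 i is Some k then v.2 ord0 k else v.1.

Lemma strip_coordinate_system (R : realType) (d : nat) :
  coordinate_system (@strip_basis R d) (@strip_coord R d).
Proof.
move=> [a v]; split=> [|i].
  rewrite big_ord_recl /strip_basis /strip_coord unlift_none /=.
  under eq_bigr do rewrite liftK /=.
  apply/pair_equal_spec; split.
    rewrite /= (raddf_sum fst) big1 ?addr0 /= => [|i _]; last by rewrite scaler0.
    by rewrite /GRing.scale /= mulr1.
  rewrite /= (raddf_sum snd) /= scaler0 add0r.
  by rewrite {1}[v]row_sum_delta.
rewrite /strip_coord prod_normE le_max; case: unlift => [k|] /=.
  by rewrite row_coord_le orbT.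
by rewrite lexx.
Qed.

(** * Composite quadrature on a mesh *)

Lemma mesh_le (R : realType) (t0 te : R) (N : nat) (t : nat -> R) (m n : nat) :
  is_mesh t0 te N t -> (m <= n <= N)%N -> t m <= t n.
Proof.
move=> [_ _ tS]; elim: n => [|n IH] /andP[mn nN].
  by move: mn; rewrite leqn0 => /eqP ->.
move: mn; rewrite leq_eqVlt => /predU1P[-> //|mn].
by apply: (le_trans (IH _)); [rewrite -ltnS mn ltnW | exact: ltW (tS _ nN)].
Qed.

Lemma mesh_cell_subset (R : realType) (t0 te : R) (N : nat) (t : nat -> R)
    (n : nat) :
  is_mesh t0 te N t -> (n < N)%N -> `[t n, t n.+1] `<=` `[t0, te].
Proof.
move=> mesh nN y /=; rewrite !in_itv /= => /andP[ty yt].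
have [t00 tNe _] := mesh; apply/andP; split.
  by rewrite -t00 (le_trans _ ty) // (mesh_le mesh) //= ltnW.
by rewrite -tNe (le_trans yt) // (mesh_le mesh) // nN leqnn.
Qed.

Lemma timestep_gt0 (R : realType) (t0 te : R) (N : nat) (t : nat -> R) (n : nat) :
  is_mesh t0 te N t -> (n < N)%N -> 0 < timestep t n.
Proof. by move=> [_ _ tS] /tS; rewrite subr_gt0. Qed.

Lemma sum_timestep (R : realType) (t0 te : R) (N : nat) (t : nat -> R) :
  is_mesh t0 te N t -> \sum_(n < N) timestep t n = te - t0.
Proof.
by move=> [<- <- _]; rewrite -(big_mkord predT (timestep t)) telescope_sumr.
Qed.

Lemma node_in_itv (R : realType) (t0 te : R) (N : nat) (t : nat -> R)
    (s : nat) (gamma : 'I_s.+1 -> R) (n : nat) (k : 'I_s.+1) :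
  0 <= gamma k <= 1 -> is_mesh t0 te N t -> (n < N)%N ->
  node gamma t n k \in `[t0, te].
Proof.
move=> /andP[g0 g1] mesh nN; apply: (mesh_cell_subset mesh nN) => /=.
have dt0 := ltW (timestep_gt0 mesh nN).
rewrite in_itv /= /node lerDl mulr_ge0 //=.
by rewrite -lerBrDl ler_piMl.
Qed.

Lemma Rintegral_mesh (R : realType) (t0 te : R) (N : nat) (t : nat -> R)
    (g : R -> R) :
  is_mesh t0 te N t -> {within `[t0, te], continuous g} ->
  \int[lebesgue_measure]_(y in `[t0, te]) g y =
  \sum_(n < N) \int[lebesgue_measure]_(y in `[t n, t n.+1]) g y.
Proof.
move=> mesh cg; have [t00 tNe tS] := mesh.
have intg a b : `[a, b] `<=` `[t0, te] ->
    lebesgue_measure.-integrable `[a, b] (EFin \o g).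
  move=> abte; apply: continuous_compact_integrable.
    exact: segment_compact.
  exact: continuous_subspaceW abte cg.
suff H m : (m <= N)%N -> \int[lebesgue_measure]_(y in `[t0, t m]) g y =
    \sum_(n < m) \int[lebesgue_measure]_(y in `[t n, t n.+1]) g y.
  by rewrite -tNe H.
elim: m => [|m IH] mN.
  by rewrite t00 set_itv1 Rintegral_set1 big_ord0.
have t0m : t0 <= t m by rewrite -t00 (mesh_le mesh) //= ltnW.
have tmS := ltW (tS _ mN).
have mte : t m.+1 <= te by rewrite -tNe (mesh_le mesh) // mN leqnn.
have int0 : lebesgue_measure.-integrable `[t0, t m.+1] (EFin \o g).
  by apply: intg; apply: subset_itvl; rewrite bnd_simp.
rewrite big_ord_recr /= -IH 1?ltnW //.
rewrite -[X in _ + X]Rintegral_itv_obnd_cbnd.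
  rewrite -(Rintegral_itvB int0) ?bnd_simp //.
  by rewrite addrC subrK.
apply: integrableS int0 => //.
by move=> y /=; rewrite !in_itv /= => /andP[ty ->]; rewrite (le_trans t0m) // ltW.
Qed.

Lemma derivatives_on_continuous (R : realType) (a b : R) (r : nat)
    (G : nat -> R -> R) :
  derivatives_on a b r G -> {within `[a, b], continuous (G 0%N)}.
Proof.
case: r => [[_ //]|r [dG _]].
exact: derivative_within_continuous (dG 0%N isT).
Qed.

Lemma derivatives_on_subset (R : realType) (a b a' b' : R) (r : nat)
    (G : nat -> R -> R) :
  `[a', b'] `<=` `[a, b] -> derivatives_on a b r G -> derivatives_on a' b' r G.
Proof.
move=> sub [dG cG]; split=> [i ir t tab|].
  by apply: (derivative_within_subset sub); apply: dG => //; exact: sub.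
exact: continuous_subspaceW sub cG.
Qed.

(** The constant [A] is independent of the mesh. The sum of the local errors is at
    most [cq * M * \sum_n dt_n ^+ r.+1], and [dt_n ^+ r.+1 <= dt_n * h ^+ r]. *)
Lemma composite_quadrature_error (R : realType) (s : nat)
    (gamma sigma : 'I_s.+1 -> R) (r : nat) (t0 te : R) (G : nat -> R -> R) :
  quadrature_order gamma sigma r -> derivatives_on t0 te r G ->
  exists A : R, 0 <= A /\ forall (N : nat) (t : nat -> R) (h : R),
    is_mesh t0 te N t -> (forall n, (n < N)%N -> timestep t n <= h) ->
    `|\int[lebesgue_measure]_(y in `[t0, te]) G 0%N y
      - \sum_(n < N) quadrature gamma sigma (t n) (timestep t n) (G 0%N)|
    <= A * (te - t0) * h ^+ r.
Proof.
move=> [cq quad] dG.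
have [M GM] : exists M, forall y, `[t0, te]%classic y -> `|G r y| <= M.
  apply: (@within_continuous_bounded R R R `[t0, te] `[t0, te]) => //.
    exact: segment_compact.
  by case: dG.
exists (`|cq| * `|M|); split=> [|N t h mesh th]; first by rewrite mulr_ge0.
rewrite (Rintegral_mesh mesh (derivatives_on_continuous dG)) -sumrB.
rewrite -(sum_timestep mesh) mulr_sumr mulr_suml.
apply: (le_trans (ler_norm_sum _ _ _)); apply: ler_sum => n _.
have dt0 := timestep_gt0 mesh (ltn_ord n).
have tE : t n + timestep t n = t n.+1 by rewrite /timestep addrC subrK.
have sub := mesh_cell_subset mesh (ltn_ord n).
have := quad (t n) (timestep t n) G dt0.
rewrite tE => /(_ (derivatives_on_subset sub dG)) err.
apply: (le_trans err).
(* The supremum is that of a real set, so its nonemptiness and boundedness have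
   to be established before it can be compared with M. *)
have supM : `|sup [set `|G r y| | y in `[t n, t n.+1]]| <= `|M|.
  have ne : [set `|G r y| | y in `[t n, t n.+1]] !=set0.
    exists `|G r (t n)|; exists (t n) => //=.
    by rewrite in_itv /= lexx -tE lerDl ltW.
  have ub : ubound [set `|G r y| | y in `[t n, t n.+1]] M.
    by move=> _ [y yt <-]; apply: GM; exact: sub.
  have sup0 : 0 <= sup [set `|G r y| | y in `[t n, t n.+1]].
    have [_ [y yt _]] := ne; apply: (@le_trans _ _ `|G r y|) => //.
    by apply: ub_le_sup; [exists M | exists y].
  by rewrite ger0_norm // (le_trans (ge_sup ne ub)) // ler_norm.
apply: (le_trans (ler_norm _)); rewrite !normrM normrX (gtr0_norm dt0) exprS.
have dtr : timestep t n ^+ r <= h ^+ r.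
  apply: lerXn2r (th n (ltn_ord n)); rewrite nnegrE ltW //.
  by rewrite (lt_le_trans dt0) // th.
set S := `|sup _| in supM *; set dt := timestep t n in dt0 dtr *.
have -> : `|cq| * (dt * dt ^+ r) * S = (`|cq| * dt) * (S * dt ^+ r) by ring.
have -> : `|cq| * `|M| * dt * h ^+ r = (`|cq| * dt) * (`|M| * h ^+ r) by ring.
apply: ler_wpM2l; first by rewrite mulr_ge0 // ltW.
by apply: ler_pM => //; [exact: normr_ge0 | rewrite exprn_ge0 // ltW].
Qed.

(** * The density and the solution on the strip *)

(** Balls of the maximum norm are enclosed in boxes, whose compactness is that of
    a product of segments. *)
Lemma strip_lipschitz (R : realType) (d : nat) (t0 te : R)
    (j : R -> 'rV[R]_d -> R) (B : R) :
  smooth_on_strip 1 t0 te j ->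
  exists L : R, 0 <= L /\ forall y v w, y \in `[t0, te] ->
    `|v| <= B -> `|w| <= B -> `|j y v - j y w| <= L * `|v - w|.
Proof.
move=> sj.
pose box := [set v : 'rV[R]_d | forall i, `[- B, B]%classic (v ord0 i)].
have boxP (v : 'rV[R]_d) : `|v| <= B -> box v.
  move=> vB i /=; rewrite in_itv /= -ler_norml.
  exact: le_trans (row_coord_le v i) vB.
have cbox : compact box.
  exact: (@rV_compact R d (fun=> `[- B, B]%classic)
    (fun=> @segment_compact _ _ _)).
have conv (lo hi a b r : R) : a \in `[lo, hi] -> b \in `[lo, hi] ->
    r \in `[0, 1] -> b + r * (a - b) \in `[lo, hi].
  by rewrite !in_itv /= => /andP[? ?] /andP[? ?] /andP[? ?]; apply/andP; split; nra.
have [|||L jL] := smooth_on1_lipschitz (K := `[t0, te] `*` box)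
    (@strip_coordinate_system R d) _ _ _ sj.
- exact: (compact_setX (@segment_compact _ t0 te) cbox).
- by move=> [y v] [].
- move=> [a v] [b w] r [/= ate vbox] [/= bte wbox] r01; split => /=.
    exact: conv.
  by move=> i /=; rewrite !mxE; apply: conv => //; [exact: vbox|exact: wbox].
exists `|L|; split=> // y v w yte vB wB.
have := jL (y, v) (y, w) (conj yte (boxP _ vB)) (conj yte (boxP _ wB)).
move=> /le_trans; apply.
have -> : `|((y, v) : R * 'rV[R]_d) - (y, w)| = `|v - w|.
  rewrite prod_normE /= subrr normr0; apply/max_idPr; exact: normr_ge0.
by rewrite ler_wpM2r // ler_norm.
Qed.

(** Passing to the graph of the solution makes the equation autonomous. *)
Lemma ivp_solution_flow (R : realType) (d : nat) (t0 te : R)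
    (f : R -> 'rV[R]_d -> 'rV[R]_d) (u0 : 'rV[R]_d) (u : R -> 'rV[R]_d) (t : R) :
  ivp_solution t0 te f u0 u -> t \in `[t0, te] ->
  derivative_within `[t0, te] (fun y => (y, u y)) t (1, f t (u t)).
Proof.
move=> [_ du] /du /derivative_withinP dut; apply/derivative_withinP => e /dut.
apply: filterS => y uy; rewrite prod_normE /= ge_max uy andbT.
rewrite /GRing.scale /= mulr1 subrr normr0.
exact: le_trans (normr_ge0 _) uy.
Qed.

Lemma solution_derivatives (R : realType) (d : nat) (t0 te : R)
    (f : R -> 'rV[R]_d -> 'rV[R]_d) (j : R -> 'rV[R]_d -> R)
    (u0 : 'rV[R]_d) (u : R -> 'rV[R]_d) (r : nat) :
  smooth_on_strip r.-1 t0 te f -> smooth_on_strip r t0 te j ->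
  ivp_solution t0 te f u0 u ->
  exists2 G : nat -> R -> R,
    G 0%N = (fun t => j t (u t)) & derivatives_on t0 te r G.
Proof.
move=> sf sj sol.
apply: (derivatives_along_flow (F := fun z => (1, f z.1 z.2))
  (c := fun t => (t, u t)) (@strip_coordinate_system R d) _ _ _ sj) => [t tte|t|i].
- by split.
- move=> tte; exact: (ivp_solution_flow sol tte).
- rewrite /strip_coord; case: (unlift _ _) => [k|]; last exact: smooth_on_cst.
  exact: smooth_on_coord.
Qed.

(** * The error in the quantity of interest *)

(** At every node both the exact and the approximate state lie in the ball of
    radius [B], where [j] is Lipschitz in the state; the cell lengths add up to
    [te - t0]. *)
Lemma qoi_perturbation (R : realType) (d s : nat) (gamma sigma : 'I_s.+1 -> R)
    (t0 te : R) (j : R -> 'rV[R]_d -> R) (u : R -> 'rV[R]_d)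
    (N : nat) (t : nat -> R) (uh : nat -> 'I_s.+1 -> 'rV[R]_d) (L B delta : R) :
  (forall y v w, y \in `[t0, te] -> `|v| <= B -> `|w| <= B ->
     `|j y v - j y w| <= L * `|v - w|) ->
  0 <= L ->
  (forall k, 0 <= gamma k <= 1) -> is_mesh t0 te N t ->
  (forall y, y \in `[t0, te] -> `|u y| + delta <= B) ->
  (forall n k, (n < N)%N -> `|uh n k - u (node gamma t n k)| <= delta) ->
  `|\sum_(n < N) quadrature gamma sigma (t n) (timestep t n) (fun y => j y (u y))
    - qoi_h gamma sigma j N t uh|
  <= (\sum_(k < s.+1) `|sigma k|) * L * (te - t0) * delta.
Proof.
move=> jL L0 gamma01 mesh uB uhu.
rewrite /qoi_h -sumrB -(sum_timestep mesh) mulr_sumr mulr_suml.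
apply: (le_trans (ler_norm_sum _ _ _)); apply: ler_sum => n _.
have dt0 := ltW (timestep_gt0 mesh (ltn_ord n)).
rewrite /quadrature -mulrBr -sumrB normrM (ger0_norm dt0).
rewrite [X in _ <= X * _]mulrC -mulrA ler_wpM2l //.
rewrite -mulrA mulr_suml.
apply: (le_trans (ler_norm_sum _ _ _)); apply: ler_sum => k _.
rewrite -mulrBr normrM ler_wpM2l //.
have nk := node_in_itv (gamma01 k) mesh (ltn_ord n).
have uhk := uhu n k (ltn_ord n).
have d0 : 0 <= delta := le_trans (normr_ge0 _) uhk.
have uk := uB _ nk.
apply: (le_trans (jL _ _ _ nk _ _)).
- by rewrite (le_trans _ uk) // lerDl.
- rewrite -[uh n k](subrK (u (node gamma t n k))) addrC.
  by rewrite (le_trans (ler_normD _ _)) // (le_trans _ uk) // lerD2l.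
- by rewrite ler_wpM2l // distrC.
Qed.

Theorem theorem4 (R : realType) (d : nat) (t0 te : R)
    (f : R -> 'rV[R]_d -> 'rV[R]_d) (j : R -> 'rV[R]_d -> R)
    (u0 : 'rV[R]_d) (u : R -> 'rV[R]_d)
    (s : nat) (gamma sigma : 'I_s.+1 -> R) (r : nat) (p q : R)
    (N : R -> nat) (t : R -> nat -> R)
    (uh : R -> nat -> 'I_s.+1 -> 'rV[R]_d) :
  t0 < te ->
  0 < p -> 0 < q ->
  smooth_on_strip r.-1 t0 te f ->
  smooth_on_strip (maxn r 1) t0 te j ->
  unique_ivp_solution t0 te f u0 u ->
  (forall k, 0 <= gamma k <= 1) ->
  quadrature_order gamma sigma r ->
  (forall tau, 0 < tau -> is_mesh t0 te (N tau) (t tau)) ->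
  (exists C : R, \forall tau \near 0^'+, forall n, (n < N tau)%N ->
     timestep (t tau) n <= C * tau `^ (1 / q)) ->
  (exists C : R, \forall tau \near 0^'+, forall n k, (n < N tau)%N ->
     `|uh tau n k - u (node gamma (t tau) n k)| <= C * tau `^ (p / q)) ->
  (fun tau : R => `|qoi t0 te j u
                    - qoi_h gamma sigma j (N tau) (t tau) (uh tau)|)
    =O_ (0^'+) (fun tau : R => tau `^ (Num.min r%:R p / q)).
Proof.
move=> t0te p0 q0 sf sj [sol _] gamma01 quad mesh [Ch steps] [Cu approx].
have sc := @strip_coordinate_system R d.
have [G GE dG] := solution_derivatives sf (smooth_on_le sc (leq_maxl r 1) sj) sol.
have [A [A0 quad_err]] := composite_quadrature_error quad dG.
have [B uB] : exists B, forall y, `[t0, te]%classic y -> `|u y| <= B.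
  apply: (@within_continuous_bounded R R _ `[t0, te] `[t0, te]) => //.
    exact: segment_compact.
  exact: derivative_within_continuous sol.2.
(* For tau <= 1 the approximate states are within `|Cu| of the exact ones. *)
have [L [L0 jL]] := strip_lipschitz (B + `|Cu|) (smooth_on_le sc (leq_maxr r 1) sj).
pose S := \sum_(k < s.+1) `|sigma k|.
pose K := A * (te - t0) * `|Ch| ^+ r + S * L * (te - t0) * `|Cu|.
have S0 : 0 <= S by exact: sumr_ge0.
have te0 : 0 <= te - t0 by rewrite subr_ge0 ltW.
have K0 : 0 <= K by rewrite addr_ge0 // !mulr_ge0 // exprn_ge0.
(* K alone may vanish, whereas a positive constant is asked for. *)
apply/eqO_exP; exists (K + 1); first by rewrite ltr_wpDl.
near=> tau.
have tau0 : 0 < tau by near: tau; exact: nbhs_right_gt.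
have tau1 : tau <= 1 by near: tau; exact: nbhs_right_le.
have step : forall n, (n < N tau)%N -> timestep (t tau) n <= Ch * tau `^ (1 / q).
  by near: tau.
have appr : forall n k, (n < N tau)%N ->
    `|uh tau n k - u (node gamma (t tau) n k)| <= Cu * tau `^ (p / q).
  by near: tau.
have tau01 : 0 < tau <= 1 by rewrite tau0.
have powle a : Num.min r%:R p <= a -> tau `^ (a / q) <= tau `^ (Num.min r%:R p / q).
  by move=> ma; apply: ger_powR => //; rewrite ler_pM2r ?invr_gt0.
(* A smaller exponent gives a larger power, as tau <= 1. *)
set T := tau `^ (Num.min r%:R p / q) in powle *.
have T0 : 0 <= T by exact: powR_ge0.
have err1 : `|qoi t0 te j u - \sum_(n < N tau)
    quadrature gamma sigma (t tau n) (timestep (t tau) n) (fun y => j y (u y))|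
    <= A * (te - t0) * `|Ch| ^+ r * T.
  have h n : (n < N tau)%N -> timestep (t tau) n <= `|Ch| * tau `^ (1 / q).
    by move=> /step /le_trans; apply; rewrite ler_wpM2r ?powR_ge0 ?ler_norm.
  have := quad_err _ _ _ (mesh _ tau0) h; rewrite GE => /le_trans; apply.
  rewrite exprMn mulrA ler_wpM2l ?mulr_ge0 ?exprn_ge0 //.
  rewrite -powR_mulrn ?powR_ge0 // -powRrM mulrC mul1r.
  by apply: powle; rewrite ge_min lexx.
have err2 : `|\sum_(n < N tau)
    quadrature gamma sigma (t tau n) (timestep (t tau) n) (fun y => j y (u y))
    - qoi_h gamma sigma j (N tau) (t tau) (uh tau)|
    <= S * L * (te - t0) * `|Cu| * T.
  have dle : `|Cu| * tau `^ (p / q) <= `|Cu|.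
    rewrite ler_piMr // -(powRr0 tau); apply: ger_powR => //.
    by rewrite divr_ge0 // ltW.
  have h n k : (n < N tau)%N ->
      `|uh tau n k - u (node gamma (t tau) n k)| <= `|Cu| * tau `^ (p / q).
    by move=> /appr /le_trans; apply; rewrite ler_wpM2r ?powR_ge0 ?ler_norm.
  apply: (le_trans (qoi_perturbation sigma jL L0 gamma01 (mesh _ tau0) _ h)).
    by move=> y yte; rewrite lerD // uB.
  rewrite mulrA ler_wpM2l ?mulr_ge0 //.
  by apply: powle; rewrite ge_min lexx orbT.
rewrite normr_id (ger0_norm T0) mulrDl mul1r /K mulrDl.
apply: ler_wpDr => //.
exact: le_trans (ler_distD _ _ _) (lerD err1 err2).
Unshelve. all: by end_near.
Qed.
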